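(* Let $H$ be a real Hilbert space, let $B:H\to H$ be a strongly positive bounded linear operator with constant $\bar\gamma>0$, let $Q:H\to H$ be a contraction mapping with constant $\alpha\in(0,1)$, and let $\gamma$ be a real number such that $0<\gamma<\frac{\bar\gamma}{\alpha}<\gamma+\frac{1}{\alpha}$. Let $S:H\to H$ be a nonexpansive mapping with $\mathrm{Fix}(S)\neq\emptyset$. Let $\{x_n\}_{n\ge 0}$ be a sequence in $H$ generated by the implicit scheme $$x_{n+1}=\alpha_n\gamma Q(x_n)+(I-\alpha_n B)\,S\!\left(\frac{x_n+x_{n+1}}{2}\right),\qquad n\ge 0,$$ where $\{\alpha_n\}$ is a sequence in $(0,1)$ satisfying: (i) $\lim_{n\to\infty}\alpha_n=0$; (ii) $\sum_{n=0}^{\infty}\alpha_n=\infty$; (iii) $\sum_{n=1}^{\infty}|\alpha_n-\alpha_{n-1}|<\infty$ or $\lim_{n\to\infty}\frac{\alpha_{n+1}}{\alpha_n}=1$. Then $\{x_n\}$ converges strongly to a point $z\in\mathrm{Fix}(S)$ such that $z=P_{\mathrm{Fix}(S)}(I-B+\gamma Q)(z)$; in other words, $z$ is the unique solution in $\mathrm{Fix}(S)$ of the variational inequality $$\langle (B-\gamma Q)z,\,x-z\rangle\ge 0\qquad\text{for all }x\in\mathrm{Fix}(S).$$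
   Context: $\langle\cdot,\cdot\rangle$ and $\|\cdot\|$ denote the inner product and norm of $H$, and $I$ is the identity operator on $H$. A mapping $Q:H\to H$ is a contraction mapping with constant $\alpha\in(0,1)$ if $\|Qx-Qy\|\le\alpha\|x-y\|$ for all $x,y\in H$. A mapping $S:H\to H$ is nonexpansive if $\|Sx-Sy\|\le\|x-y\|$ for all $x,y\in H$. $\mathrm{Fix}(S)$ is the set of fixed points of $S$. A bounded linear operator $B:H\to H$ is strongly positive with constant $\bar\gamma>0$ if $\langle Bx,x\rangle\ge\bar\gamma\|x\|^2$ for all $x\in H$. For a nonempty closed convex set $K\subset H$, $P_K$ denotes the metric (nearest point) projection of $H$ onto $K$. *)

(* Defs.v *)
From HB Require Import structures.
From mathcomp Require Import all_boot all_order all_algebra.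
From mathcomp Require Import all_classical all_reals all_analysis.

Set Implicit Arguments.
Unset Strict Implicit.
Unset Printing Implicit Defensive.

Import Order.TTheory GRing.Theory Num.Theory.
Import numFieldNormedType.Exports.

Local Open Scope classical_set_scope.
Local Open Scope ring_scope.

(* A real Hilbert space is a [completeNormedModType] over a [realType], together
   with an inner product [dot : {dot H for idfun}] (a symmetric positive definite
   bilinear form) that induces the norm of [H]. *)
Definition induces_norm (R : realType) (H : normedModType R)
    (dot : {dot H for idfun}) : Prop :=
  forall x : H, `|x| = Num.sqrt (dot x x).

Definition bounded_operator (R : realType) (H : normedModType R)
    (B : {linear H -> H}) : Prop :=
  bounded_near B (nbhs (0 : H)).

Definition strongly_positive (R : realType) (H : normedModType R)
    (dot : {dot H for idfun}) (c : R) (B : {linear H -> H}) : Prop :=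
  0 < c /\ forall x : H, c * `|x| ^+ 2 <= dot (B x) x.

Definition contraction_mapping (R : realType) (H : normedModType R)
    (k : R) (Q : H -> H) : Prop :=
  0 < k < 1 /\ forall x y : H, `|Q x - Q y| <= k * `|x - y|.

Definition nonexpansive (R : realType) (H : normedModType R) (S : H -> H) : Prop :=
  forall x y : H, `|S x - S y| <= `|x - y|.

Definition Fix (T : Type) (S : T -> T) : set T := [set x | S x = x].

Definition nearest_points (R : realType) (H : normedModType R)
    (K : set H) (y : H) : set H :=
  [set z | K z /\ forall w, K w -> `|y - z| <= `|y - w|].

(* When [K] is nonempty, closed and convex in a Hilbert space,
   [nearest_points K y] is a singleton, so the default value 0 is never used and
   the choice made by [xget] is the only one. *)
Definition metric_proj (R : realType) (H : normedModType R)
    (K : set H) (y : H) : H :=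
  xget 0 (nearest_points K y).

Definition solves_VI (R : realType) (H : normedModType R)
    (dot : {dot H for idfun}) (A : H -> H) (K : set H) (z : H) : Prop :=
  K z /\ forall x, K x -> 0 <= dot (A z) (x - z).

(* Main.v *)
(** Since [B] need not be self-adjoint, the usual bound
    |I - aB| <= 1 - a * gammabar is replaced by |I - aB| <= 1 - a * c, valid for
    every fixed c < gammabar once a is small enough; c is chosen so that
    c > gamma * alpha, and a tail of the sequence is considered.

    Boundedness, asymptotic regularity and |x_n - S x_n| -> 0 follow from
    recurrences to which Xu's lemma applies.  The remaining point is
    limsup <u - z, x_n - z> <= 0, where u = z - Bz + gamma Qz.  Weak compactness
    and demiclosedness are avoided as follows.  Browder's path
    S y_k = y_k + (y_k - u) / (k + 1) is Cauchy, because monotonicity of I - S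
    gives |y_m - y_k|^2 <= |y_m - u|^2 - |y_k - u|^2 for k <= m; its limit is the
    projection of u onto Fix S, hence equals z.  Monotonicity of I - S between
    x_n and y_k bounds <u - y_k, x_n - y_k> by (k + 1) |x_n - S x_n| |x_n - y_k|,
    and letting first n, then k tend to infinity gives the claim. *)

Require Import Defs.
From HB Require Import structures.
From mathcomp Require Import all_boot all_order all_algebra.
From mathcomp Require Import all_classical all_reals all_analysis.
From mathcomp Require Import ring lra.

Set Implicit Arguments.
Unset Strict Implicit.
Unset Printing Implicit Defensive.

Import Order.TTheory GRing.Theory Num.Theory.
Import numFieldNormedType.Exports.

Local Open Scope classical_set_scope.
Local Open Scope ring_scope.

(** * Recurrence inequalities *)

Lemma sum_ord_shift (V : nmodType) (F : nat -> V) (N n : nat) : (N <= n)%N ->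
  \sum_(i < n) F i = \sum_(i < N) F i + \sum_(i < n - N) F (N + i)%N.
Proof. by move=> Nn; rewrite -(subnKC Nn) addKn big_split_ord. Qed.

(* The factor [1 + sum t] stands in for the reciprocal of the infinite product
   of the [1 - t i]; it already diverges with [sum t]. *)
Lemma recurrence_potential_le (R : realFieldType) (e : R) (s t c : nat -> R) (n : nat) :
  0 <= e -> (forall k, 0 <= s k) -> (forall k, 0 <= t k <= 1) ->
  (forall k, 0 <= c k) ->
  (forall k, s k.+1 <= (1 - t k) * s k + t k * e + c k) ->
  (s n - e - \sum_(i < n) c i) * (1 + \sum_(i < n) t i) <= s 0%N.
Proof.
move=> e0 s0 t01 c0 rec; elim: n => [|n IH].
  by rewrite !big_ord0; have := s0 0%N; lra.
rewrite !big_ord_recr /=.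
have T0 : 0 <= \sum_(i < n) t i by apply: sumr_ge0 => i _; case/andP: (t01 i).
have C0 : 0 <= \sum_(i < n) c i by apply: sumr_ge0.
move: (rec n) (s0 0%N) (c0 n) IH; case/andP: (t01 n).
set T := \sum_(i < n) t i in T0 *; set C := \sum_(i < n) c i in C0 *.
set X := s n - e - C.
move=> t0 t1 rn s00 cn IH.
have X' : s n.+1 - e - (C + c n) <= (1 - t n) * X.
    have tC := mulr_ge0 t0 C0; rewrite /X.
    by lra.
(* If [X <= 0] the left side is nonpositive; otherwise [(1 - t n) * (1 + T + t n) <= 1 + T] closes
   the induction. *)
have [X0|X0] := leP X 0.
  have /le_trans -> // : (s n.+1 - e - (C + c n)) * (1 + (T + t n)) <= 0.
  apply: mulr_le0_ge0; last lra.
  by apply: le_trans X' _; apply: mulr_ge0_le0; lra.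
apply: le_trans IH.
apply: (@le_trans _ _ ((1 - t n) * X * (1 + (T + t n)))).
  by apply: ler_wpM2r => //; lra.
have -> : (1 - t n) * X * (1 + (T + t n)) = X * (1 + T) - X * (t n * T + t n ^+ 2) by ring.
rewrite lerBlDr lerDl; apply: mulr_ge0; first exact: ltW.
by rewrite addr_ge0 ?sqr_ge0 ?mulr_ge0.
Qed.

Lemma bounded_sum_tail (R : realType) (c : nat -> R) (C e : R) :
  (forall k, 0 <= c k) -> (forall n, \sum_(i < n) c i <= C) -> 0 < e ->
  exists N, forall n k, (N <= n)%N -> \sum_(i < k) c (n + i)%N <= e.
Proof.
move=> c0 cC e0.
have ub : has_ubound (range (fun n => \sum_(i < n) c i)).
  by exists C => _ [n _ <-].
have hs : has_sup (range (fun n => \sum_(i < n) c i)).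
  by split=> //; exists (\sum_(i < 0) c i), 0%N.
have [_ [N _ <-] supN] := sup_adherent e0 hs.
exists N => n k Nn.
have supnk : \sum_(i < n + k) c i <= sup (range (fun n => \sum_(i < n) c i)).
  by apply: ub_le_sup => //; exists (n + k)%N.
have Nn' : \sum_(i < N) c i <= \sum_(i < n) c i.
  by rewrite [leRHS](sum_ord_shift _ Nn) lerDl; exact: sumr_ge0.
by move: supnk; rewrite big_split_ord /=; lra.
Qed.

(** Far out, [b] and the tail sums of [c] are at most [e / 3]; the potential inequality for the
    shifted sequence then bounds [s n - 2e/3] times [1 + sum t] by a constant, while [sum t]
    diverges. *)
Lemma xu_lemma (R : realType) (s t b c : nat -> R) (C : R) :
  (forall n, 0 <= s n) -> (forall n, 0 <= t n <= 1) ->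
  (forall M, exists n, M <= \sum_(i < n) t i) ->
  (forall e, 0 < e -> \forall n \near \oo, b n <= e) ->
  (forall n, 0 <= c n) -> (forall n, \sum_(i < n) c i <= C) ->
  (forall n, s n.+1 <= (1 - t n) * s n + t n * b n + c n) ->
  s n @[n --> \oo] --> (0 : R).
Proof.
move=> s0 t01 tdiv bsup c0 cC rec.
apply/cvgr0Pnorm_le => e e0.
have e3 : 0 < e / 3 by rewrite divr_gt0.
have [N1 _ bN] := bsup _ e3.
have [N2 cN] := bounded_sum_tail c0 cC e3.
pose N := maxn N1 N2.
have key k : (s (N + k)%N - e / 3 - \sum_(i < k) c (N + i)%N) *
    (1 + \sum_(i < k) t (N + i)%N) <= s N.
  have := @recurrence_potential_le R (e / 3) (fun k => s (N + k)%N)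
    (fun k => t (N + k)%N) (fun k => c (N + k)%N) k.
  rewrite addn0; apply => //; first exact: ltW.
  move=> j; rewrite addnS; apply: le_trans (rec _) _.
  rewrite lerD2r lerD2l ler_wpM2l//; first by case/andP: (t01 (N + j)%N).
  by apply: bN => /=; rewrite (leq_trans (leq_maxl _ _) (leq_addr _ _)).
(* [K] makes the sum of [t] from index [N] on at least [s N / (e / 3)], so that a later [s n > e]
   would push the left side of [key] beyond [s N]. *)
have [K Kdiv] := tdiv (s N / (e / 3) + \sum_(i < N) t i).
exists (N + K)%N => // n /= NKn.
have Nn : (N <= n)%N := leq_trans (leq_addr _ _) NKn.
rewrite ger0_norm// leNgt; apply/negP => sn.
have := key (n - N)%N; rewrite subnKC//.
have cs : \sum_(i < n - N) c (N + i)%N <= e / 3.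
  by apply: cN; exact: leq_maxr.
have Ts : s N / (e / 3) <= \sum_(i < n - N) t (N + i)%N.
  have h : \sum_(i < K) t i <= \sum_(i < n) t i.
    have Kn : (K <= n)%N := leq_trans (leq_addl _ _) NKn.
    rewrite [leRHS](sum_ord_shift _ Kn) lerDl; apply: sumr_ge0 => i _.
    by case/andP: (t01 (K + i)%N).
  by have := sum_ord_shift t Nn; lra.
apply/negP; rewrite -ltNge; apply: (@lt_le_trans _ _ (e / 3 * (1 + s N / (e / 3)))).
  by rewrite mulrDr mulr1 mulrCA divff ?gt_eqF// mulr1; lra.
have sN0 : 0 <= s N / (e / 3) by rewrite divr_ge0 // ltW.
by apply: ler_pM; lra.
Qed.

(** The weight [D n] arises when the [s n.+1] part of an implicit estimate moves to the left.
    Dividing by it keeps the sum divergent, since [D n <= 1], and at most doubles [c n], since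
    [D n >= 1/2]. *)
Lemma xu_lemma_weighted (R : realType) (s D t b c : nat -> R) (C : R) :
  (forall n, 0 <= s n) -> (forall n, 2^-1 <= D n <= 1) ->
  (forall n, 0 <= t n <= D n) ->
  (forall M, exists n, M <= \sum_(i < n) t i) ->
  (forall e, 0 < e -> \forall n \near \oo, b n <= e) ->
  (forall n, 0 <= c n) -> (forall n, \sum_(i < n) c i <= C) ->
  (forall n, D n * s n.+1 <= (D n - t n) * s n + t n * b n + c n) ->
  s n @[n --> \oo] --> (0 : R).
Proof.
move=> s0 D1 tD tdiv bsup c0 cC rec.
have D0 n : 0 < D n by have := D1 n; lra.
apply: (@xu_lemma _ s (fun n => t n / D n) b (fun n => 2 * c n) (2 * C)) => //.
- move=> n; have /andP[t0 t1] := tD n; apply/andP; split.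
    by rewrite divr_ge0// ltW.
  by rewrite ler_pdivrMr// mul1r.
- move=> M; have [n Mn] := tdiv M; exists n; apply: le_trans Mn _.
  apply: ler_sum => i _; rewrite ler_pdivlMr// ler_piMr//.
    by case/andP: (tD i).
  by case/andP: (D1 i).
- by move=> n; apply: mulr_ge0.
- by move=> n; rewrite -mulr_sumr ler_wpM2l.
- move=> n; rewrite -(ler_pM2l (D0 n)); apply: le_trans (rec n) _.
  have -> : D n * ((1 - t n / D n) * s n + t n / D n * b n + 2 * c n) =
    (D n - t n) * s n + t n * b n + D n * 2 * c n by field; rewrite gt_eqF.
  by rewrite lerD2l ler_peMl//; have := D1 n; lra.
Qed.

Lemma le_recurrence_bounded (R : realFieldType) (s D t : nat -> R) (K : R) :
  0 <= K -> (forall n, 0 < D n) -> (forall n, 0 <= t n <= D n) ->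
  (forall n, D n * s n.+1 <= (D n - t n) * s n + t n * K) ->
  forall n, s n <= Num.max (s 0%N) K.
Proof.
move=> K0 D0 tD rec; elim=> [|n IH]; first by rewrite le_max lexx.
have KM : K <= Num.max (s 0%N) K by rewrite le_max lexx orbT.
rewrite -(ler_pM2l (D0 n)); apply: le_trans (rec n) _.
by move: (tD n) IH KM; set M := Num.max _ _; nra.
Qed.

(** * Inner product identities *)

Lemma midpoint_sub (R : numFieldType) (V : lmodType R) (x y z : V) :
  2^-1 *: (x + y) - z = 2^-1 *: ((x - z) + (y - z)).
Proof.
rewrite addrACA -opprD scalerBr -[z + z]mulr2n -[z *+ 2]scaler_nat scalerA.
by rewrite mulVf// scale1r.
Qed.

Section InnerProduct.
Context {R : realType} {H : completeNormedModType R} (dot : {dot H for idfun}).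
Hypothesis dot_norm : induces_norm dot.

Lemma dotC x y : dot x y = dot y x.
Proof. by have := hermC dot x y; rewrite expr0 mul1r. Qed.

Lemma dotxx x : dot x x = `|x| ^+ 2.
Proof.
rewrite dot_norm sqr_sqrtr//; have [->|x0] := eqVneq x 0.
  by rewrite linear0l.
exact/ltW/neq0_dnorm_gt0.
Qed.

Lemma dotDl x y z : dot (x + y) z = dot x z + dot y z.
Proof. exact: linearDl. Qed.

Lemma dotDr x y z : dot x (y + z) = dot x y + dot x z.
Proof. exact: linearDr. Qed.

Lemma dotNl x y : dot (- x) y = - dot x y.
Proof. exact: linearNl. Qed.

Lemma dotNr x y : dot x (- y) = - dot x y.
Proof. exact: linearNr. Qed.

Lemma dotZl k x y : dot (k *: x) y = k * dot x y.
Proof. exact: linearZl_LR. Qed.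

Lemma dotZr k x y : dot x (k *: y) = k * dot x y.
Proof. exact: linearZr_LR. Qed.

Definition dotE := (dotDl, dotDr, dotNl, dotNr, dotZl, dotZr).

Lemma sqr_normD x y : `|x + y| ^+ 2 = `|x| ^+ 2 + 2 * dot x y + `|y| ^+ 2.
Proof. by rewrite -!dotxx !dotE (dotC y x); ring. Qed.

Lemma sqr_normB x y : `|x - y| ^+ 2 = `|x| ^+ 2 - 2 * dot x y + `|y| ^+ 2.
Proof. by rewrite sqr_normD dotNr normrN; ring. Qed.

(** Cauchy-Schwarz, read off from the square of the triangle inequality. *)
Lemma dot_le x y : dot x y <= `|x| * `|y|.
Proof.
have : `|x + y| ^+ 2 <= (`|x| + `|y|) ^+ 2.
  by rewrite ler_sqr ?nnegrE ?addr_ge0// ler_normD.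
by rewrite sqr_normD; lra.
Qed.

Lemma sqr_norm_mid (x y z : H) :
  `|2^-1 *: (x + y) - z| ^+ 2 <= (`|x - z| ^+ 2 + `|y - z| ^+ 2) / 2.
Proof.
rewrite midpoint_sub; move: (x - z) (y - z) => a b; have := sqr_ge0 `|a - b|.
by rewrite normrZ exprMn ger0_norm// sqr_normB sqr_normD; lra.
Qed.

Lemma nonexpansive_monotone (S : H -> H) : nonexpansive S ->
  forall x y, 0 <= dot ((x - S x) - (y - S y)) (x - y).
Proof.
move=> Sne x y.
have -> : (x - S x) - (y - S y) = (x - y) - (S x - S y).
  by rewrite !opprD !opprK addrACA.
rewrite dotDl dotNl dotxx subr_ge0 (le_trans (dot_le _ _))// expr2.
by rewrite ler_wpM2r.
Qed.

End InnerProduct.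

(** * Banach's fixed point theorem on the whole space *)

Lemma contraction_has_fixpoint (R : realType) (H : completeNormedModType R)
    (f : H -> H) (q : R) : 0 <= q -> q < 1 ->
  (forall x y, `|f x - f y| <= q * `|x - y|) -> exists p, f p = p.
Proof.
move=> q0 q1 fq.
pose F : {fun [set: H] >-> [set: H]} :=
  HB.pack f (isFun.Build H H setT setT f (fun _ _ => Logic.I)).
have Fc : is_contraction F.
  by exists (NngNum q0); split=> //= -[x y] _ /=; exact: fq.
have [p _ pE] := banach_fixed_point Fc closedT (ex_intro _ 0 Logic.I).
by exists p.
Qed.

(** * Browder's path *)

Section BrowderPath.
Context {R : realType} {H : completeNormedModType R} (dot : {dot H for idfun}).
Hypothesis dot_norm : induces_norm dot.
Variables (S : H -> H) (u : H).
Hypothesis S_nonexp : nonexpansive S.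

(** Equivalently [y k = (1 - t) S (y k) + t u] with [t = 1/(k + 2)]; the form chosen exposes
    [y k - S (y k)] as a multiple of [u - y k], ready for monotonicity. *)
Definition browder_path (y : nat -> H) :=
  forall k, S (y k) = y k + k.+1%:R^-1 *: (y k - u).

Lemma browder_path_exists : exists y, browder_path y.
Proof.
suff h (k : nat) : exists y, S y = y + k.+1%:R^-1 *: (y - u).
  by have [y yP] := choice h; exists y.
pose l : R := k.+1%:R^-1.
have l0 : 0 < l by rewrite invr_gt0.
have [||x y|y yE] := @contraction_has_fixpoint R H
    (fun w => (1 + l)^-1 *: (S w + l *: u)) (1 + l)^-1.
- by rewrite invr_ge0; lra.
- by rewrite invf_lt1; lra.
- rewrite -scalerBr opprD addrACA subrr addr0 normrZ gtr0_norm ?invr_gt0; last lra.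
  by rewrite ler_wpM2l// invr_ge0; lra.
- have SyE : S y + l *: u = (1 + l) *: y.
    by rewrite -[in RHS]yE scalerA divff ?scale1r// gt_eqF//; lra.
  by exists y; rewrite -(addrK (l *: u) (S y)) SyE scalerDl scale1r scalerBr addrA.
Qed.

Variable (y : nat -> H).
Hypothesis y_path : browder_path y.

(** Monotonicity of [I - S] between [y k] and [p] gives [dot (y k - u) (p - y k) >= 0]: the angle at
    [y k] is not acute. *)
Lemma browder_path_fix p k : Fix S p ->
  `|y k - u| ^+ 2 + `|p - y k| ^+ 2 <= `|p - u| ^+ 2.
Proof.
move=> Sp; have := nonexpansive_monotone dot_norm S_nonexp (y k) p.
rewrite Sp subrr subr0 y_path opprD addNKr dotNl dotZl -mulrN -dotNr opprB.
rewrite pmulr_rge0 ?invr_gt0//.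
have -> : p - u = (y k - u) + (p - y k) by rewrite [RHS]addrC addrA subrK.
by move: (y k - u) (p - y k) => a b; rewrite (sqr_normD dot_norm); lra.
Qed.

Lemma browder_path_dist k m : (k <= m)%N ->
  `|y m - y k| ^+ 2 <= `|y m - u| ^+ 2 - `|y k - u| ^+ 2.
Proof.
rewrite leq_eqVlt => /predU1P[->|km]; first by rewrite !subrr normr0 expr0n.
have := nonexpansive_monotone dot_norm S_nonexp (y m) (y k).
rewrite !y_path !opprD !addNKr.
have -> : y m - y k = (y m - u) - (y k - u) by rewrite opprB addrA subrK.
move: (y m - u) (y k - u) => a b.
rewrite (sqr_normB dot_norm) !dotE !opprK (dotC dot b a) !(dotxx dot_norm).
have lm : 0 < m.+1%:R^-1 :> R by rewrite invr_gt0.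
have lkm : m.+1%:R^-1 < k.+1%:R^-1 :> R by rewrite ltf_pV2 ?posrE// ltr_nat.
have := sqr_ge0 `|a - b|; rewrite (sqr_normB dot_norm).
have := sqr_ge0 `|a|; have := sqr_ge0 `|b|.
set s : R := m.+1%:R^-1 in lm lkm *; set t : R := k.+1%:R^-1 in lkm *.
set A := `|a| ^+ 2; set B := `|b| ^+ 2; set D := dot a b.
move=> B0 A0 AB h.
(* Monotonicity reads [s * A + t * B <= (s + t) * D]. Nonnegativity of the left side of [key] forces
   [B <= A], after which [t - s] may be enlarged to [s + t]. *)
have key : (s + t) * (A - 2 * D + B) <= (t - s) * (A - B) by lra.
have BA : B <= A.
  rewrite -subr_ge0 -(@pmulr_rge0 _ (t - s)) ?subr_gt0//.
  by apply: le_trans key; apply: mulr_ge0 => //; lra.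
have sBA : 0 <= s * (A - B) by apply: mulr_ge0; lra.
by rewrite -(@ler_pM2l _ (s + t)); lra.
Qed.

(** The squared distances to [u] are bounded through any fixed point; once one of them is within
    [e ^+ 2] of their supremum, [browder_path_dist] keeps all later points within [e]. *)
Lemma browder_path_cvg : Fix S !=set0 -> cvgn y.
Proof.
move=> [p Sp].
apply/cauchy_cvgP/cauchy_exP => e e0.
have hs : has_sup (range (fun n => `|y n - u| ^+ 2)).
  split; first by exists (`|y 0%N - u| ^+ 2), 0%N.
  exists (`|p - u| ^+ 2) => _ [n _ <-].
  by have := browder_path_fix n Sp; have := sqr_ge0 `|p - y n|; lra.
have [_ [N _ <-] supN] := sup_adherent (exprn_gt0 2 e0) hs.
exists (y N); exists N => // n /= Nn.
rewrite -ball_normE /= distrC -ltr_sqr ?nnegrE//; last exact: ltW.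
apply: le_lt_trans (browder_path_dist Nn) _.
have : `|y n - u| ^+ 2 <= sup (range (fun n => `|y n - u| ^+ 2)).
  by apply: ub_le_sup; [case: hs|exists n].
by lra.
Qed.

Lemma browder_path_lim_fix q : y n @[n --> \oo] --> q -> Fix S q.
Proof.
move=> yq.
have Sy : S (y n) @[n --> \oo] --> S q.
  apply/cvgrPdist_le => e e0; move/cvgrPdist_le : yq => /(_ e e0).
  by apply: filterS => n; apply: le_trans; exact: S_nonexp.
have Sy' : S (y n) @[n --> \oo] --> q + (0 : R) *: (q - u).
  under eq_fun do rewrite y_path.
  apply: cvgD => //; apply: cvgZ; last exact: cvgB yq (cvg_cst _).
  exact: cvg_harmonic.
have := cvg_unique (@norm_hausdorff R H) Sy Sy'; rewrite scale0r addr0; exact.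
Qed.

(** The limit of [browder_path_fix] is a Pythagorean inequality; expanding [p - u] as
    [(q - u) + (p - q)] turns it into the claim. *)
Lemma browder_path_lim_VI q p : y n @[n --> \oo] --> q -> Fix S p ->
  0 <= dot (q - u) (p - q).
Proof.
move=> yq Sp.
have cv : (`|y n - u| ^+ 2 + `|p - y n| ^+ 2) @[n --> \oo] -->
          (`|q - u| ^+ 2 + `|p - q| ^+ 2).
  have cu : `|y n - u| @[n --> \oo] --> `|q - u|.
    by apply: cvg_norm; exact: cvgB yq (cvg_cst _).
  have cp : `|p - y n| @[n --> \oo] --> `|p - q|.
    by apply: cvg_norm; exact: cvgB (cvg_cst _) yq.
  exact: cvgD (cvgM cu cu) (cvgM cp cp).
have : `|q - u| ^+ 2 + `|p - q| ^+ 2 <= `|p - u| ^+ 2.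
  apply: (cvgr_to_le cv).
  by apply: nearW => k; exact: browder_path_fix.
have -> : p - u = (q - u) + (p - q) by rewrite [RHS]addrC addrA subrK.
by move: (q - u) (p - q) => a b; rewrite (sqr_normD dot_norm); lra.
Qed.

End BrowderPath.

(** * Variational inequalities *)

Section VariationalInequality.
Context {R : realType} {H : completeNormedModType R} (dot : {dot H for idfun}).
Hypothesis dot_norm : induces_norm dot.

Lemma solves_VI_unique (A : H -> H) (K : set H) (b : R) (z z' : H) : 0 < b ->
  (forall x y, b * `|x - y| ^+ 2 <= dot (A x - A y) (x - y)) ->
  solves_VI dot A K z -> solves_VI dot A K z' -> z = z'.
Proof.
move=> b0 Amono [Kz zVI] [Kz' z'VI].
apply/eqP; rewrite -subr_eq0 -normr_eq0 -sqrf_eq0 eq_le sqr_ge0 andbT.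
rewrite -(pmulr_rle0 _ b0); apply: le_trans (Amono z z') _.
have := zVI _ Kz'; have := z'VI _ Kz; rewrite -(opprB z z').
by rewrite dotDl dotNl dotNr; lra.
Qed.

(** Expansion around [z] gives [|u - w|^2 >= |u - z|^2 + |w - z|^2] on [K], so [z] is the only
    nearest point and [xget] must return it. *)
Lemma solves_VI_metric_proj (K : set H) (u z : H) :
  solves_VI dot (fun w => w - u) K z -> z = metric_proj K u.
Proof.
move=> [Kz zVI]; rewrite /metric_proj.
have sqr_dist w : `|u - w| ^+ 2 =
    `|u - z| ^+ 2 + 2 * dot (z - u) (w - z) + `|w - z| ^+ 2.
  have -> : u - w = - ((z - u) + (w - z)) by rewrite [z - u + _]addrC addrA subrK opprB.
  by rewrite normrN (distrC u z); move: (z - u) (w - z) => p q; exact: sqr_normD.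
apply/esym/xget_unique.
  split=> // w Kw; rewrite -ler_sqr ?nnegrE// (sqr_dist w).
  by have := zVI _ Kw; have := sqr_ge0 `|w - z|; lra.
move=> w [Kw /(_ z Kz)]; rewrite -ler_sqr ?nnegrE// (sqr_dist w) => wz.
apply/eqP; rewrite -subr_eq0 -normr_eq0 -sqrf_eq0 eq_le sqr_ge0 andbT.
by have := zVI _ Kw; lra.
Qed.

(** A fixed point of [w |-> P (w - s A w)] solves the inequality, where [P] is the projection
    supplied by the last hypothesis. *)
Lemma solves_VI_exists (A : H -> H) (K : set H) (b L : R) : 0 < b -> b <= L ->
  (forall x y, b * `|x - y| ^+ 2 <= dot (A x - A y) (x - y)) ->
  (forall x y, `|A x - A y| <= L * `|x - y|) ->
  (forall u, exists z, solves_VI dot (fun w => w - u) K z) ->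
  exists z, solves_VI dot A K z.
Proof.
move=> b0 bL Amono Alip projK; have [P PK] := choice projK.
have L0 : 0 < L by exact: lt_le_trans b0 bL.
have P_nonexp u v : `|P u - P v| <= `|u - v|.
  have [Ku uVI] := PK u; have [Kv vVI] := PK v.
  (* Adding the two projection inequalities shows [P] firmly nonexpansive. *)
  have h : `|P u - P v| ^+ 2 <= dot (u - v) (P u - P v).
    have := uVI _ Kv; have := vVI _ Ku; rewrite -(opprB (P u) (P v)).
    rewrite -(dotxx dot_norm) !dotNr.
    by rewrite !dotDl !dotNl; lra.
  have := le_trans h (dot_le dot_norm _ _); rewrite expr2.
  have [->|PP0] := eqVneq (P u - P v) 0; first by rewrite normr0.
  by rewrite ler_pM2r// normr_gt0.
(* This [s] minimizes [1 - 2 s b + s^2 L^2], the bound on the squared contraction constant; the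
   minimum is [q2], nonnegative because [b <= L]. *)
pose s := b / L ^+ 2.
have s0 : 0 < s by rewrite divr_gt0 ?exprn_gt0.
pose q2 := 1 - b ^+ 2 / L ^+ 2.
have q20 : 0 <= q2.
  by rewrite subr_ge0 ler_pdivrMr ?exprn_gt0// mul1r ler_sqr ?nnegrE// ltW.
have q21 : q2 < 1 by rewrite ltrBlDr ltrDl divr_gt0 ?exprn_gt0.
have [||x y|z zE] := @contraction_has_fixpoint R H (fun w => P (w - s *: A w))
    (Num.sqrt q2).
- exact: sqrtr_ge0.
- by rewrite -[ltRHS]sqrtr1 ltr_sqrt.
- apply: le_trans (P_nonexp _ _) _.
  rewrite opprD addrACA -opprD -scalerBr -ler_sqr ?nnegrE ?mulr_ge0 ?sqrtr_ge0//.
  rewrite exprMn sqr_sqrtr// (sqr_normB dot_norm) dotZr normrZ exprMn dotC.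
  have sDr : b ^+ 2 / L ^+ 2 * `|x - y| ^+ 2 <= s * dot (A x - A y) (x - y).
    have -> : b ^+ 2 / L ^+ 2 * `|x - y| ^+ 2 = s * (b * `|x - y| ^+ 2).
      by rewrite /s; ring.
    by rewrite ler_pM2l.
  have sNr : `|s| ^+ 2 * `|A x - A y| ^+ 2 <= b ^+ 2 / L ^+ 2 * `|x - y| ^+ 2.
    have -> : b ^+ 2 / L ^+ 2 * `|x - y| ^+ 2 = `|s| ^+ 2 * (L * `|x - y|) ^+ 2.
      by rewrite gtr0_norm// /s; field; rewrite gt_eqF.
    by rewrite ler_wpM2l ?sqr_ge0// ler_sqr ?nnegrE ?mulr_ge0// ltW.
  by rewrite /q2; lra.
- exists z; have [Kz zVI] := PK (z - s *: A z); rewrite zE in Kz zVI.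
  split=> // x /zVI; by rewrite opprB addrC subrK dotZl pmulr_rge0.
Qed.

End VariationalInequality.

(** * Limsup inequality for approximate fixed points *)

Section BrowderLimsup.
Context {R : realType} {H : completeNormedModType R} (dot : {dot H for idfun}).
Hypothesis dot_norm : induces_norm dot.
Variable S : H -> H.
Hypotheses (S_nonexp : nonexpansive S) (FixS_neq0 : Fix S !=set0).

(** Serves twice: it supplies the projection of [u] onto [Fix S], and a path towards it with which
    other sequences can be compared. *)
Lemma browder_lim (u : H) : exists y z, [/\ browder_path S u y,
  y n @[n --> \oo] --> z & solves_VI dot (fun w => w - u) (Fix S) z].
Proof.
have [y y_path] := browder_path_exists u S_nonexp.
have y_cvg : cvgn y := browder_path_cvg dot_norm S_nonexp y_path FixS_neq0.
exists y, (limn y); split=> //; split.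
  by apply: browder_path_lim_fix y_cvg.
move=> p Sp; exact: (browder_path_lim_VI dot_norm S_nonexp y_path y_cvg).
Qed.

Lemma solves_VI_limsup (u z : H) (x : nat -> H) (C : R) :
  solves_VI dot (fun w => w - u) (Fix S) z ->
  (forall n, `|x n - z| <= C) ->
  `|x n - S (x n)| @[n --> \oo] --> (0 : R) ->
  forall e, 0 < e -> \forall n \near \oo, dot (u - z) (x n - z) <= e.
Proof.
move=> zVI xC xS e e0; have [y [z' [y_path yz' z'VI]]] := browder_lim u.
have zz' : z' = z.
  apply: (solves_VI_unique ltr01 _ z'VI zVI) => v w.
  by rewrite mul1r opprB addrA subrK (dotxx dot_norm).
rewrite zz' in yz'; rename yz' into yz.
have C0 : 0 <= C := le_trans (normr_ge0 _) (xC 0%N).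
(* [C'] bounds [|x n - y k|] once [|y k - z| <= 1]; [E] collects the coefficients of [|y k - z|] in
   the last two terms of the final decomposition. *)
pose C' := C + 1.
have C'0 : 0 < C' by rewrite /C'; lra.
pose E := C' + `|u - z|.
have E0 : 0 < E by rewrite ltr_pwDl.
have [k [yk1 yk]] : exists k, `|y k - z| <= 1 /\ `|y k - z| * E <= e / 2.
  have [k _ hk] : \forall k \near \oo, `|y k - z| <= Num.min 1 (e / 2 / E).
    move/cvgrPdist_le : yz => /(_ (Num.min 1 (e / 2 / E))).
    rewrite lt_min ltr01 !divr_gt0// => /(_ isT).
    by apply: filterS => n; rewrite distrC.
  exists k; have := hk k (leqnn k).
  by rewrite le_min ler_pdivlMr// => /andP.
have xyC n : `|x n - y k| <= C'.
  apply: le_trans (ler_distD z _ _) _; rewrite lerD//.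
  by rewrite distrC.
have l0 : 0 < k.+1%:R^-1 :> R by rewrite invr_gt0.
set l : R := k.+1%:R^-1 in l0.
have [N _ xN] : \forall n \near \oo, `|x n - S (x n)| <= l * (e / 2) / C'.
  move/cvgr0_norm_le : xS => /(_ (l * (e / 2) / C')).
  rewrite !(divr_gt0, mulr_gt0)// => /(_ isT).
  by apply: filterS => n; rewrite normr_id.
exists N => // n /= /xN xnS.
have yx : dot (u - y k) (x n - y k) <= e / 2.
  rewrite -(ler_pM2l l0).
  have := nonexpansive_monotone dot_norm S_nonexp (x n) (y k).
  have -> : y k - S (y k) = l *: (u - y k).
    by rewrite y_path opprD addNKr -scalerN opprB.
  rewrite dotDl dotNl dotZl.
  rewrite subr_ge0 => /le_trans; apply; apply: le_trans (dot_le dot_norm _ _) _.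
  apply: (@le_trans _ _ (l * (e / 2) / C' * C')); first exact: ler_pM.
  by rewrite divfK// gt_eqF.
have yz1 : dot (y k - z) (x n - y k) <= `|y k - z| * C'.
  by apply: le_trans (dot_le dot_norm _ _) _; rewrite ler_wpM2l.
have yz2 : dot (u - z) (y k - z) <= `|u - z| * `|y k - z| := dot_le dot_norm _ _.
have -> : dot (u - z) (x n - z) =
    dot (u - y k) (x n - y k) + dot (y k - z) (x n - y k) + dot (u - z) (y k - z).
  by rewrite -dotDl addrA subrK -dotDr addrA subrK.
by move: yk; rewrite /E; lra.
Qed.

End BrowderLimsup.

(** Prepares the difference of consecutive instances of the scheme: [p] and [Y] stand for the mixed
    terms pairing the new coefficient with the old point. *)
Lemma subrBB_telescope (V : zmodType) (u p v s t X Y Z : V) :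
  u + (s - X) - (v + (t - Z)) = (u - p) + ((p - v) - (Y - Z)) + ((s - t) - (X - Y)).
Proof.
rewrite (addrA (u - p)) (subrKA p) opprD addrACA -[RHS]addrA; congr (_ + _).
rewrite [RHS]addrCA -opprD [_ - Z + _]addrC subrKA.
by rewrite !opprB [LHS](AC (2*2) ((1*4)*(3*2))).
Qed.

(** * The implicit midpoint scheme *)

Section ImplicitMidpointScheme.
Context {R : realType} {H : completeNormedModType R} (dot : {dot H for idfun}).
Hypothesis dot_norm : induces_norm dot.
Variables (S G : H -> H) (B : {linear H -> H}) (c k M : R).
Variables (a : nat -> R) (x : nat -> H) (z : H).
Hypotheses (S_nonexp : nonexpansive S) (k0 : 0 <= k) (kc : k < c).
Hypothesis G_lip : forall v w, `|G v - G w| <= k * `|v - w|.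
Hypothesis B_bound : forall v, `|B v| <= M * `|v|.
Hypothesis a_gt0 : forall n, 0 < a n.
Hypothesis ac_le1 : forall n, a n * c <= 1.
Hypothesis acc_le : forall n, a n * c ^+ 2 <= c - k.
Hypothesis B_contr : forall n v, `|v - a n *: B v| <= (1 - a n * c) * `|v|.
Hypothesis a_to0 : a n @[n --> \oo] --> (0 : R).
Hypothesis a_div : forall C : R, exists n, C <= \sum_(i < n) a i.
Hypothesis a_reg : (exists C : R, forall n, \sum_(i < n) `|a i.+1 - a i| <= C) \/
  (a n.+1 / a n @[n --> \oo] --> (1 : R)).
Hypothesis x_scheme : forall n, let s := S (2^-1 *: (x n + x n.+1)) in
  x n.+1 = a n *: G (x n) + (s - a n *: B s).
Hypothesis z_VI : solves_VI dot (fun w => B w - G w) (Fix S) z.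

Let m n := 2^-1 *: (x n + x n.+1).

Let Sz : S z = z. Proof. exact: z_VI.1. Qed.

Let c0 : 0 < c. Proof. exact: le_lt_trans kc. Qed.

(** The midpoint puts weight [(1 - a n * c) / 2] on the new iterate; moved to the left, it leaves
    [D n]. The old iterate keeps [(1 - a n * c) / 2 + a n * k], which is [D n - t n] for the [t]
    below. *)
Let D n : R := (1 + a n * c) / 2.

Let D_bounds n : 2^-1 <= D n <= 1.
Proof.
have := ac_le1 n; have := mulr_gt0 (a_gt0 n) c0.
by rewrite /D; lra.
Qed.

Let t n : R := a n * (c - k).

Let t_bounds n : 0 <= t n <= D n.
Proof.
have := ac_le1 n; have := mulr_ge0 (ltW (a_gt0 n)) k0.
have := mulr_gt0 (a_gt0 n) c0.
have : 0 <= t n by rewrite mulr_ge0 ?ltW// subr_gt0.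
by rewrite /D /t mulrBr; lra.
Qed.

Let t_div C : exists n, C <= \sum_(i < n) t i.
Proof.
have [n Cn] := a_div (C / (c - k)); exists n.
by rewrite -mulr_suml -ler_pdivrMr// subr_gt0.
Qed.

Let scheme_sub p n :
  x n.+1 - p = ((S (m n) - p) - a n *: B (S (m n) - p)) + a n *: (G (x n) - B p).
Proof.
rewrite {1}x_scheme -/(m n) linearB !scalerBr opprB [RHS]addrACA.
by rewrite [a n *: B p - _ - _]addrAC subrr add0r !addrA [LHS](ACl (2*4*1*3))/=.
Qed.

Let mid_le p n : `|m n - p| <= (`|x n - p| + `|x n.+1 - p|) / 2.
Proof.
by rewrite /m midpoint_sub normrZ ger0_norm// mulrC ler_wpM2r// ler_normD.
Qed.

(** [K] is chosen so that [a n * |G z - B z| = t n * K], the form required by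
    [le_recurrence_bounded]. *)
Let x_bounded : exists2 C, 0 <= C & forall n, `|x n - z| <= C.
Proof.
pose K := `|G z - B z| / (c - k).
have ck : 0 < c - k by rewrite subr_gt0.
have K0 : 0 <= K by rewrite divr_ge0// ltW.
exists (Num.max `|x 0%N - z| K); first by rewrite le_max K0 orbT.
apply: (@le_recurrence_bounded R (fun n => `|x n - z|) D t K K0) => // n.
  by have := D_bounds n; lra.
have h1 : `|x n.+1 - z| <= (1 - a n * c) * `|S (m n) - z| + a n * `|G (x n) - B z|.
  rewrite [in leLHS]scheme_sub; apply: le_trans (ler_normD _ _) _.
  by rewrite normrZ (gtr0_norm (a_gt0 n)) lerD2r B_contr.
have h2 : `|S (m n) - z| <= (`|x n - z| + `|x n.+1 - z|) / 2.
  by rewrite -{1}Sz; exact: le_trans (S_nonexp _ _) (mid_le _ _).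
have h3 : `|G (x n) - B z| <= k * `|x n - z| + K * (c - k).
  rewrite divfK ?gt_eqF// -(subrKA (G z)).
  by apply: le_trans (ler_normD _ _) _; rewrite lerD2r.
have h4 : (1 - a n * c) * `|S (m n) - z| <=
    (1 - a n * c) * ((`|x n - z| + `|x n.+1 - z|) / 2).
  by rewrite ler_wpM2l// subr_ge0.
have h5 : a n * `|G (x n) - B z| <= a n * (k * `|x n - z| + K * (c - k)).
  by rewrite ler_wpM2l// ltW.
by rewrite /D /t; lra.
Qed.

Let Sm_le C n : (forall n, `|x n - z| <= C) -> `|S (m n) - z| <= C.
Proof.
move=> xC; rewrite -{1}Sz; apply: le_trans (S_nonexp _ _) _.
by apply: le_trans (mid_le _ _) _; have := xC n; have := xC n.+1; lra.
Qed.

(** This vector is multiplied by [a n.+1 - a n] when consecutive steps are compared, and by [a n] in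
    the residual [x n - S (x n)]. *)
Let drift_bounded : exists2 C, 0 <= C & forall n, `|G (x n) - B (S (m n))| <= C.
Proof.
have [C C0 xC] := x_bounded.
exists (k * C + `|G z - B z| + `|M| * C); first by rewrite !addr_ge0 ?mulr_ge0.
move=> n; rewrite -(subrKA (G z)) -(subrKA (B z) (G z)) addrA.
apply: le_trans (ler_normD _ _) _; apply: lerD.
  apply: le_trans (ler_normD _ _) _; rewrite lerD2r.
  by apply: le_trans (G_lip _ _) _; rewrite ler_wpM2l.
rewrite -linearB; apply: le_trans (B_bound _) _.
rewrite distrC; apply: le_trans (ler_wpM2r _ (ler_norm M)) _ => //.
by rewrite ler_wpM2l// Sm_le.
Qed.

Let step_le : exists2 C, 0 <= C & forall n,
  D n.+1 * `|x n.+2 - x n.+1| <=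
  (D n.+1 - t n.+1) * `|x n.+1 - x n| + C * `|a n.+1 - a n|.
Proof.
have [C C0 dC] := drift_bounded; exists C => // n.
have e : x n.+2 - x n.+1 =
    (a n.+1 *: (G (x n.+1) - G (x n)) + (a n.+1 - a n) *: (G (x n) - B (S (m n)))) +
    ((S (m n.+1) - S (m n)) - a n.+1 *: B (S (m n.+1) - S (m n))).
  rewrite [x n.+2 in LHS]x_scheme [X in _ - X = _]x_scheme -/(m n) -/(m n.+1).
  rewrite (subrBB_telescope _ (a n.+1 *: G (x n)) _ _ _ _ (a n.+1 *: B (S (m n)))).
  by rewrite (linearB B) !scalerBr !scalerBl.
have ap := a_gt0 n.+1.
have h0 : `|x n.+2 - x n.+1| <= a n.+1 * `|G (x n.+1) - G (x n)| +
    `|a n.+1 - a n| * `|G (x n) - B (S (m n))| +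
    (1 - a n.+1 * c) * `|S (m n.+1) - S (m n)|.
  rewrite {1}e; apply: le_trans (ler_normD _ _) _; apply: lerD => //.
  by apply: le_trans (ler_normD _ _) _; rewrite !normrZ (gtr0_norm ap).
have h1 : a n.+1 * `|G (x n.+1) - G (x n)| <= a n.+1 * (k * `|x n.+1 - x n|).
  by rewrite ler_pM2l.
have h2 : `|a n.+1 - a n| * `|G (x n) - B (S (m n))| <= `|a n.+1 - a n| * C.
  by rewrite ler_wpM2l.
have h3 : `|S (m n.+1) - S (m n)| <= (`|x n.+2 - x n.+1| + `|x n.+1 - x n|) / 2.
  apply: le_trans (S_nonexp _ _) _; rewrite /m -scalerBr normrZ ger0_norm// mulrC.
  by rewrite ler_wpM2r// opprD addrACA [leRHS]addrC ler_normD.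
have h4 : (1 - a n.+1 * c) * `|S (m n.+1) - S (m n)| <=
   (1 - a n.+1 * c) * ((`|x n.+2 - x n.+1| + `|x n.+1 - x n|) / 2).
  by rewrite ler_wpM2l// subr_ge0.
by rewrite /D /t; lra.
Qed.

Let step_cvg0 : `|x n.+1 - x n| @[n --> \oo] --> (0 : R).
Proof.
have [C C0 rec] := step_le.
have tS_div C' : exists n, C' <= \sum_(i < n) t i.+1.
  have [n tn] := t_div (C' + t 0%N); exists n.
  have : \sum_(i < n) t i <= \sum_(i < n.+1) t i.
    by rewrite big_ord_recr lerDl; case/andP: (t_bounds n).
  by rewrite big_ord_recl /=; lra.
(* Summable variation enters as the summable error [c]; in the ratio case the error is instead
   factored as [t n.+1 * b n] with [b] tending to 0. *)
have [[A aA]|ratio] := a_reg.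
  apply: (@xu_lemma_weighted R _ (fun n => D n.+1) (fun n => t n.+1) (fun=> 0)
    (fun n => C * `|a n.+1 - a n|) (C * A)) => //.
  - by move=> e e0; apply: nearW => n; exact: ltW.
  - by move=> n; rewrite mulr_ge0.
  - by move=> n; rewrite -mulr_sumr ler_wpM2l.
  - by move=> n; rewrite mulr0 addr0.
pose b n := C / (c - k) * `|1 - (a n.+1 / a n)^-1|.
have ck : 0 < c - k by rewrite subr_gt0.
apply: (@xu_lemma_weighted R _ (fun n => D n.+1) (fun n => t n.+1) b
    (fun=> 0) 0) => //.
- move=> e e0.
  have : b n @[n --> \oo] --> C / (c - k) * `|1 - (1 : R)^-1|.
    apply: cvgM; first exact: cvg_cst.
    apply: cvg_norm; apply: cvgB; first exact: cvg_cst.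
    by apply: cvgV => //; exact: oner_neq0.
  by rewrite invr1 subrr normr0 mulr0 => /cvgr_le; apply.
- by move=> n; rewrite big1.
- move=> n; rewrite addr0; apply: le_trans (rec n) _; rewrite lerD2l.
  have -> : a n.+1 - a n = a n.+1 * (1 - (a n.+1 / a n)^-1).
    by field; rewrite !gt_eqF.
  rewrite normrM (gtr0_norm (a_gt0 _)) /t /b.
  set X := `|_|.
  have -> // : a n.+1 * (c - k) * (C / (c - k) * X) = C * (a n.+1 * X).
  by field; rewrite gt_eqF.
Qed.

(** Through [x n.+1] and [S (m n)], the residual is at most one step, plus [a n] times the drift,
    plus [|m n - x n|], which is half a step. *)
Let fix_cvg0 : `|x n - S (x n)| @[n --> \oo] --> (0 : R).
Proof.
have [C C0 dC] := drift_bounded.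
have bnd n : `|x n - S (x n)| <= 2 * `|x n.+1 - x n| + a n * C.
  have e : x n - S (x n) =
      (x n - x n.+1) + (a n *: (G (x n) - B (S (m n))) + (S (m n) - S (x n))).
    have -> : a n *: (G (x n) - B (S (m n))) + (S (m n) - S (x n)) = x n.+1 - S (x n).
      by rewrite x_scheme -/(m n) scalerBr addrA; congr (_ - _); rewrite addrAC -addrA.
    by rewrite addrA subrK.
  have h1 : `|x n - S (x n)| <= `|x n - x n.+1| +
      (`|a n *: (G (x n) - B (S (m n)))| + `|S (m n) - S (x n)|).
    by rewrite {1}e (le_trans (ler_normD _ _))// lerD2l ler_normD.
  have h2 : `|S (m n) - S (x n)| <= `|x n.+1 - x n|.
    apply: le_trans (S_nonexp _ _) _; apply: le_trans (mid_le _ _) _.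
    by rewrite subrr normr0 add0r; have := normr_ge0 (x n.+1 - x n); lra.
  have h3 : `|a n *: (G (x n) - B (S (m n)))| <= a n * C.
    by rewrite normrZ gtr0_norm// ler_pM2l.
  by move: h1; rewrite (distrC (x n) (x n.+1)); lra.
apply: (@squeeze_cvgr _ _ _ _ (fun=> 0) (fun n => 2 * `|x n.+1 - x n| + a n * C)).
- by apply: nearW => n; rewrite normr_ge0 bnd.
- exact: cvg_cst.
- have -> : (0 : R) = 2 * 0 + 0 * C by rewrite mulr0 mul0r addr0.
  apply: cvgD; apply: cvgM => //; exact: cvg_cst.
Qed.

Lemma implicit_midpoint_cvg : x n @[n --> \oo] --> z.
Proof.
have [C C0 xC] := x_bounded.
have ck : 0 < c - k by rewrite subr_gt0.
(* With [u = z - (B z - G z)], [z] becomes the projection of [u], and [u - z] is the vector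
   [G z - B z] of [sg]. *)
have z_VI' : solves_VI dot (fun w => w - (z - (B z - G z))) (Fix S) z.
  by split=> [|p Sp]; rewrite ?opprB ?[z + _]addrC ?addrNK; [exact: Sz|exact: z_VI.2].
have sup := solves_VI_limsup dot_norm S_nonexp (ex_intro _ z Sz) z_VI' xC fix_cvg0.
pose sg n := dot (G z - B z) (x n.+1 - z).
pose X n := `|x n - z| ^+ 2.
(* By [acc_le], [(1 - a n * c)^2 + 2 * a n * k <= 1 - t n]; the midpoint splits this factor equally
   between [X n] and [X n.+1], whence the weight [(1 + t n) / 2]. *)
have rec n : (1 + t n) / 2 * X n.+1 <=
    ((1 + t n) / 2 - t n) * X n + t n * (2 / (c - k) * sg n).
  set V := (S (m n) - z) - a n *: B (S (m n) - z).
  have e1 : X n.+1 <= `|V| ^+ 2 + 2 * (a n * dot (G (x n) - B z) (x n.+1 - z)).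
    rewrite /X -dotZl; have -> : V = (x n.+1 - z) - a n *: (G (x n) - B z).
      by rewrite [in RHS]scheme_sub addrK.
    move: (x n.+1 - z) (a n *: (G (x n) - B z)) => p w.
    by rewrite (sqr_normB dot_norm) (dotC dot p); have := sqr_ge0 `|w|; lra.
  have e2 : `|V| ^+ 2 <= (1 - a n * c) ^+ 2 * ((X n + X n.+1) / 2).
    have SmX : `|S (m n) - z| ^+ 2 <= (X n + X n.+1) / 2.
      apply: le_trans (sqr_norm_mid dot_norm _ _ _).
      by rewrite ler_sqr ?nnegrE// -[in leLHS]Sz; exact: S_nonexp.
    apply: (@le_trans _ _ ((1 - a n * c) ^+ 2 * `|S (m n) - z| ^+ 2)).
      by rewrite -exprMn ler_sqr ?nnegrE ?mulr_ge0 ?subr_ge0//; exact: B_contr.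
    by rewrite ler_wpM2l ?sqr_ge0.
  have e3 : dot (G (x n) - B z) (x n.+1 - z) <= k * ((X n + X n.+1) / 2) + sg n.
    rewrite -(subrKA (G z)) dotDl lerD2r; apply: le_trans (dot_le dot_norm _ _) _.
    apply: (@le_trans _ _ (k * `|x n - z| * `|x n.+1 - z|)); first exact: ler_wpM2r.
    rewrite -mulrA ler_wpM2l//; have := sqr_ge0 (`|x n - z| - `|x n.+1 - z|).
    by rewrite /X; lra.
  have X0 i : 0 <= X i by exact: sqr_ge0.
  have e4 : a n * dot (G (x n) - B z) (x n.+1 - z) <=
      a n * (k * ((X n + X n.+1) / 2) + sg n) by rewrite ler_pM2l.
  have e5 : a n * (a n * c ^+ 2) * (X n + X n.+1) <= a n * (c - k) * (X n + X n.+1).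
    by rewrite ler_wpM2r ?addr_ge0// ler_pM2l.
  have -> : t n * (2 / (c - k) * sg n) = 2 * (a n * sg n).
    by rewrite /t; field; rewrite gt_eqF.
  by rewrite /t; lra.
have t1 n : t n <= 1 by have := t_bounds n; have := D_bounds n; lra.
have Xcv : X n @[n --> \oo] --> (0 : R).
  apply: (@xu_lemma_weighted R X (fun n => (1 + t n) / 2) t
    (fun n => 2 / (c - k) * sg n) (fun=> 0) 0) => //.
  - by move=> n; exact: sqr_ge0.
  - by move=> n; have := t1 n; have := t_bounds n; lra.
  - by move=> n; have := t1 n; have := t_bounds n; lra.
  - move=> e e0; have e'0 : 0 < e * (c - k) / 2 by rewrite divr_gt0 ?mulr_gt0.
    have [N _ hN] := sup _ e'0.
    (* [sg n] involves [x n.+1], so the limsup bound is read one index later. *)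
    exists N => // n /= Nn; have := hN n.+1 (leqW Nn).
    rewrite addrAC subrr add0r opprB -/(sg n) => sgn.
    by rewrite mulrAC ler_pdivrMr// mulrC -ler_pdivlMr.
  - by move=> n; rewrite big1.
  - by move=> n; rewrite addr0.
apply/cvgrPdist_le => e e0.
have e2 : 0 < e ^+ 2 by rewrite exprn_gt0.
move/cvgr0_norm_le : Xcv => /(_ _ e2); apply: filterS => n.
by rewrite /X ger0_norm ?sqr_ge0// ler_sqr ?nnegrE ?(ltW e0)// distrC.
Qed.

End ImplicitMidpointScheme.

(** * Reduction of the theorem to a tail of the scheme *)

Lemma nneseries_pinfty_unbounded (R : realType) (a : nat -> R) (N : nat) (C : R) :
  (forall n, 0 <= a n) -> (\sum_(0 <= n <oo) (a n)%:E = +oo)%E ->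
  exists n, C <= \sum_(i < n) a (i + N)%N.
Proof.
move=> a0 a_sum; apply/not_existsP => aC.
have aC' n : \sum_(i < n) a (i + N)%N <= C by rewrite leNgt; apply/negP => /ltW /(aC n).
have : (\sum_(0 <= n <oo) (a n)%:E <= (C + \sum_(i < N) a i)%:E)%E.
  apply: lime_le; first by apply: is_cvg_nneseries => n _ _; rewrite lee_fin.
  exists N => // n /= Nn; rewrite sumEFin lee_fin big_mkord (sum_ord_shift _ Nn) addrC.
  by rewrite lerD2r; under eq_bigr do rewrite addnC.
by rewrite a_sum leye_eq.
Qed.

Lemma nneseries_lty_bounded (R : realType) (a : nat -> R) :
  (forall n, 0 <= a n) -> (\sum_(1 <= n <oo) (a n)%:E < +oo)%E ->
  exists C : R, forall n, \sum_(i < n) a i.+1 <= C.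
Proof.
move=> a0 a_sum; exists (fine (\sum_(1 <= n <oo) (a n)%:E)%E) => n.
rewrite -lee_fin fineK; last first.
  rewrite ge0_fin_numE//; apply: nneseries_ge0 => k _ _; by rewrite lee_fin.
apply: le_trans (nneseries_lim_ge n.+1 _); last by move=> k _ _; rewrite lee_fin.
by rewrite sumEFin big_add1 big_mkord.
Qed.

(** Expanding the square gives the factor [1 - 2ag + a^2 M^2], at most [1 - 2ac] by the smallness of
    [a], hence at most [(1 - ac)^2]. *)
Lemma strongly_positive_contr (R : realType) (H : completeNormedModType R)
    (dot : {dot H for idfun}) (B : {linear H -> H}) (g c M a : R) :
  induces_norm dot -> strongly_positive dot g B ->
  (forall v, `|B v| <= M * `|v|) ->
  0 <= a -> a * c <= 1 -> a * M ^+ 2 <= 2 * (g - c) ->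
  forall v, `|v - a *: B v| <= (1 - a * c) * `|v|.
Proof.
move=> dot_norm [_ B_pos] B_bound a0 ac1 aM v.
rewrite -ler_sqr ?nnegrE ?mulr_ge0 ?subr_ge0// (sqr_normB dot_norm) dotZr dotC.
rewrite normrZ (ger0_norm a0) !exprMn.
have h1 : a * (g * `|v| ^+ 2) <= a * dot (B v) v by rewrite ler_wpM2l.
have h2 : a * (a * `|B v| ^+ 2) <= a * (a * (M ^+ 2 * `|v| ^+ 2)).
  rewrite !ler_wpM2l// -exprMn ler_sqr ?nnegrE//.
  exact: le_trans (normr_ge0 _) (B_bound v).
have h3 : a * `|v| ^+ 2 * (a * M ^+ 2) <= a * `|v| ^+ 2 * (2 * (g - c)).
  by rewrite ler_wpM2l// mulr_ge0// sqr_ge0.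
have h4 : 0 <= (a * c * `|v|) ^+ 2 by exact: sqr_ge0.
lra.
Qed.

Theorem theorem3p1 (R : realType) (H : completeNormedModType R)
    (dot : {dot H for idfun}) (dot_norm : induces_norm dot)
    (B : {linear H -> H}) (gammabar : R)
    (B_bounded : bounded_operator B)
    (B_pos : strongly_positive dot gammabar B)
    (Q : H -> H) (alpha : R) (Q_contr : contraction_mapping alpha Q)
    (gamma : R)
    (gamma_bounds : [&& 0 < gamma, gamma < gammabar / alpha
                      & gammabar / alpha < gamma + 1 / alpha])
    (S : H -> H) (S_nonexp : nonexpansive S) (FixS_neq0 : Fix S !=set0)
    (a : nat -> R) (a_in01 : forall n, 0 < a n < 1)
    (a_to0 : a n @[n --> \oo] --> (0 : R))
    (a_sum : (\sum_(0 <= n <oo) (a n)%:E = +oo)%E)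
    (a_reg : (\sum_(1 <= n <oo) `|a n - a n.-1|%:E < +oo)%E \/
             (a n.+1 / a n @[n --> \oo] --> (1 : R)))
    (x : nat -> H)
    (x_scheme : forall n,
       let s := S (2^-1 *: (x n + x n.+1)) in
       x n.+1 = (a n * gamma) *: Q (x n) + (s - a n *: B s)) :
  exists z : H,
    [/\ x n @[n --> \oo] --> z,
        Fix S z,
        z = metric_proj (Fix S) (z - B z + gamma *: Q z)
      & unique (solves_VI dot (fun y => B y - gamma *: Q y) (Fix S)) z].
Proof.
have [/andP[alpha0 _] Q_lip] := Q_contr.
have [g0 B_mono] := B_pos.
have /and3P[gamma0 + _] := gamma_bounds; rewrite ltr_pdivlMr// => kg.
(* [b] is the strong monotonicity constant of [B - gamma Q]. *)
pose k := gamma * alpha; pose b := gammabar - k.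
have k0 : 0 < k by exact: mulr_gt0.
have b0 : 0 < b by rewrite subr_gt0.
pose G w := gamma *: Q w.
have G_lip v w : `|G v - G w| <= k * `|v - w|.
  by rewrite -scalerBr normrZ gtr0_norm// -mulrA ler_pM2l.
have [M M0 B_bound] : exists2 M, 0 < M & forall v, `|B v| <= M * `|v|.
  by have /linear_boundedP/pinfty_ex_gt0[M M0 MB] := B_bounded; exists M.
have A_sub v w : B v - G v - (B w - G w) = B (v - w) - (G v - G w).
  by rewrite (linearB B) !opprD addrACA.
have A_mono v w : b * `|v - w| ^+ 2 <= dot (B v - G v - (B w - G w)) (v - w).
  rewrite A_sub dotDl dotNl; have := B_mono (v - w).
  have : dot (G v - G w) (v - w) <= k * `|v - w| ^+ 2.
    by apply: le_trans (dot_le dot_norm _ _) _; rewrite expr2 mulrA ler_wpM2r.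
  by rewrite /b; lra.
(* [M + k] is already a Lipschitz constant; [b] is added to secure the [b <= L] of
   [solves_VI_exists]. *)
have A_lip v w : `|B v - G v - (B w - G w)| <= (M + k + b) * `|v - w|.
  rewrite A_sub; apply: le_trans (ler_normB _ _) _.
  have := B_bound (v - w); have := G_lip v w.
  by have := mulr_ge0 (ltW b0) (normr_ge0 (v - w)); lra.
have bL : b <= M + k + b by lra.
have proj u : exists z, solves_VI dot (fun w => w - u) (Fix S) z.
  by have [y [z [_ _ zVI]]] := browder_lim dot_norm S_nonexp FixS_neq0 u; exists z.
have [z zVI] := solves_VI_exists dot_norm b0 bL A_mono A_lip proj.
exists z; split; last first.
- by split=> // z'; exact: (solves_VI_unique b0 A_mono).
- apply: (solves_VI_metric_proj dot_norm); split=> [|p Sp]; first exact: zVI.1.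
  have -> : z - (z - B z + gamma *: Q z) = B z - G z.
    by rewrite opprD opprB addrA addrCA subrr addr0.
  exact: zVI.2.
- exact: zVI.1.
(* The midpoint of [k] and [gammabar]: the gap above [k] drives the recurrences, the gap below
   [gammabar] absorbs the quadratic term in the bound on [I - aB]. *)
pose c := gammabar - b / 2.
have kc : k < c by move: b0; rewrite /c /b; lra.
have c0 : 0 < c by exact: lt_trans kc.
have a_gt0 n : 0 < a n by case/andP: (a_in01 n).
have a_small d e : 0 < d -> 0 < e -> \forall n \near \oo, a n * d <= e.
  move=> d0 e0; have : \forall n \near \oo, a n <= e / d.
    by apply: (cvgr_le _ a_to0); rewrite divr_gt0.
  by apply: filterS => n; rewrite ler_pdivlMr.
have [N _ aN] : \forall n \near \oo,
    [/\ a n * c <= 1, a n * c ^+ 2 <= c - k & a n * M ^+ 2 <= 2 * (gammabar - c)].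
  have ck : 0 < c - k by rewrite subr_gt0.
  have gc : 0 < 2 * (gammabar - c) by rewrite /c; lra.
  by near=> n; split; near: n; apply: a_small => //; rewrite exprn_gt0.
have aN' n : [/\ a (n + N)%N * c <= 1, a (n + N)%N * c ^+ 2 <= c - k &
    a (n + N)%N * M ^+ 2 <= 2 * (gammabar - c)].
  by apply: aN => /=; exact: leq_addl.
rewrite -(cvg_shiftn N).
apply: (@implicit_midpoint_cvg R H dot dot_norm S G B c k M (fun n => a (n + N)%N)) => //.
- exact: ltW.
- by move=> n; case: (aN' n).
- by move=> n; case: (aN' n).
- move=> n; have [ac1 _ aM] := aN' n.
  exact: strongly_positive_contr dot_norm B_pos B_bound (ltW (a_gt0 _)) ac1 aM.
- by rewrite (cvg_shiftn N).
- by move=> C; apply: nneseries_pinfty_unbounded => // n; exact: ltW.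
- case: a_reg => [a_var|a_ratio]; [left|right].
    have [C aC] := nneseries_lty_bounded (fun n => normr_ge0 (a n - a n.-1)) a_var.
    exists C => n; apply: le_trans (aC (N + n)%N).
    rewrite (sum_ord_shift (fun i => `|a i.+1 - a i|) (leq_addr n N)) addKn.
    by under eq_bigr do rewrite addSn addnC; rewrite lerDr sumr_ge0.
  rewrite -(cvg_shiftn N) in a_ratio.
  exact: a_ratio.
- by move=> n; have := x_scheme (n + N)%N; rewrite -scalerA.
Unshelve. all: by end_near. Qed.
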